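(* Let $\mathcal{A}=\{f(m): m\in\mathbb{N}\}$ be the set of values of $f$, and let $\mathcal{A}(x)=\{a\in\mathcal{A}: a\le x\}$. Then $$\#\mathcal{A}(x)=x^{O(\log\log\log x/\log\log x)}\qquad\text{as } x\to\infty.$$ That is, there exist absolute constants $C>0$ and $x_0$ such that for all real $x\ge x_0$, $$\#\mathcal{A}(x)\le x^{C\log\log\log x/\log\log x}.$$
   Context: For a positive integer $n$, $f(n)$ denotes the number of distinct unordered factorisations of $n$ into integer factors larger than $1$, i.e. the number of finite multisets of integers $>1$ whose product is $n$ (the one-factor factorisation $n$ itself is counted when $n>1$). For example $f(28)=4$, from $28,\ 2\cdot 14,\ 4\cdot 7,\ 2\cdot 2\cdot 7$. Here $\mathbb{N}$ is the set of positive integers and $\log$ is the natural logarithm. *)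

(* Defs.v *)
From HB Require Import structures.
From mathcomp Require Import all_boot all_order all_algebra.
From mathcomp Require Import finmap multiset.
From mathcomp Require Import all_classical all_reals all_analysis.

Set Implicit Arguments.
Unset Strict Implicit.
Unset Printing Implicit Defensive.

Import Order.TTheory GRing.Theory Num.Theory.

Local Open Scope classical_set_scope.
Local Open Scope ring_scope.

Definition factorisations (n : nat) : set {mset nat}%mset :=
  [set s : {mset nat}%mset |
    (forall d : nat, d \in s -> (1 < d)%N) /\ (\prod_(d <- s) d)%N = n].

(* [fset_set] sends an infinite set to the empty one. The two cardinals below
   are genuine by [finite_factorisations] (for [0 < n]; the value at [0] is
   junk and never used) and [finite_values_le]. *)
Definition nb_factorisations (n : nat) : nat := #|` fset_set (factorisations n)|.

Definition values : set nat :=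
  nb_factorisations @` [set m : nat | (0 < m)%N].

Definition values_le (R : realType) (x : R) : set nat :=
  [set a : nat | values a /\ a%:R <= x].

Definition card_values_le (R : realType) (x : R) : nat :=
  #|` fset_set (values_le x)|.

Lemma leq_prod_seq (s : seq nat) :
  (forall d : nat, d \in s -> (1 < d)%N) ->
  (size s <= \prod_(d <- s) d)%N /\
  (forall d : nat, d \in s -> (d <= \prod_(d <- s) d)%N).
Proof.
elim: s => [|e s IHs] hs; first by rewrite big_nil.
have e1 : (1 < e)%N by apply: hs; rewrite inE eqxx.
have hs' d : d \in s -> (1 < d)%N by move=> ds; apply: hs; rewrite inE ds orbT.
have [hsize hmem] := IHs hs'.
have p0 : (0 < \prod_(d <- s) d)%N.
  by rewrite big_seq_cond prodn_cond_gt0// => d; rewrite andbT => /hs'/ltnW.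
rewrite big_cons; split=> /= [|d].
  by apply: (leq_ltn_trans hsize); rewrite ltn_Pmull.
rewrite inE => /orP[/eqP->|/hmem dp]; first by rewrite leq_pmulr.
by rewrite (leq_trans dp)// leq_pmull// ltnW.
Qed.

Lemma finite_factorisations (n : nat) :
  (0 < n)%N -> finite_set (factorisations n).
Proof.
move=> n0.
pose g (b : n.-bseq 'I_n.+1) : {mset nat}%mset :=
  seq_mset [seq nat_of_ord i | i <- b].
apply: (@sub_finite_set _ _ (g @` setT)); last exact: finite_image.
move=> s [s1 sn].
have [hsize hmem] := leq_prod_seq s1; rewrite sn in hsize hmem.
pose t : seq 'I_n.+1 := [seq inord d | d <- s].
have ht : (size t <= n)%N by rewrite size_map.
exists (Bseq ht) => //; rewrite /g /=.
rewrite -map_comp (_ : [seq _ | i <- s] = s :> seq nat) ?seq_mset_id//.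
rewrite -[RHS]map_id; apply/eq_in_map => d ds /=.
by rewrite inordK// ltnS hmem.
Qed.

Lemma finite_values_le (R : realType) (x : R) : finite_set (values_le x).
Proof.
apply: (@sub_finite_set _ _ `I_(Num.truncn x).+1); last exact: finite_II.
move=> a [_ ax] /=; rewrite ltnS.
by rewrite truncn_ge_nat// (le_trans _ ax).
Qed.

(* Main.v *)
Require Import Defs.
From mathcomp Require Import all_boot all_order all_algebra.
From mathcomp Require Import finmap multiset.
From mathcomp Require Import all_classical all_reals all_analysis.
From mathcomp Require Import zify ring lra.

(* f(n) depends only on the multiset of exponents of n. Suppose f(n) <= x and
   put L = log x, y = log log x. The divisors p, p^2, ..., p^s can be used
   independently as factors, so if j primes have exponent at least (s+1)^2 then
   f(n) >= 2^(j s): with j = 1, all exponents are O(L^2); with s ~ y^2, all but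
   O(L / y^2) of them are O(y^4). If 2m primes divide n, attaching m of them to
   the m others in all possible ways gives f(n) >= m^m, so n has O(L / y) prime
   factors. The number of exponent patterns is therefore at most
   O(L^2)^O(L / y^2) * O(y^4)^O(L / y) = exp(O(L log y / y)). *)

Import Order.TTheory GRing.Theory Num.Theory.

Local Open Scope nat_scope.

(** * Comparing numbers of factorisations through injections *)

Lemma leq_card_fset_set (T U : choiceType) (A : set T) (B : set U)
    (f : T -> U) : finite_set A -> finite_set B ->
  (forall x, A x -> B (f x)) ->
  (forall x y, A x -> A y -> f x = f y -> x = y) ->
  #|` fset_set A| <= #|` fset_set B|.
Proof.
move=> finA finB AB injf.
have memA x : x \in fset_set A -> A x by rewrite in_fset_set// inE.
rewrite -(size_map f); apply: uniq_leq_size.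
  by rewrite map_inj_in_uniq ?fset_uniq// => x y /memA Ax /memA Ay; exact: injf.
move=> _ /mapP[x /memA Ax ->].
by rewrite in_fset_set// inE; exact: AB.
Qed.

(** Stated on sequences, so that multisets are handled through representatives up to [perm_eq]. *)
Definition factorises (n : nat) (s : seq nat) : bool :=
  all (ltn 1) s && (\prod_(d <- s) d == n).

Lemma factorisesP (n : nat) (s : {mset nat}%mset) :
  factorisations n s <-> factorises n s.
Proof.
split=> [[s1 sn]|/andP[/allP s1 /eqP sn]]; last by split.
by apply/andP; split; [exact/allP|exact/eqP].
Qed.

Lemma perm_factorises (n : nat) (s t : seq nat) :
  perm_eq s t -> factorises n s = factorises n t.
Proof. by move=> st; rewrite /factorises (perm_all _ st) (perm_big _ st). Qed.

Lemma leq_nb_factorisations (n n' : nat) (phi : nat -> nat) :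
  0 < n -> 0 < n' ->
  (forall s, factorises n s -> factorises n' (map phi s)) ->
  (forall s t, factorises n s -> factorises n t ->
     perm_eq (map phi s) (map phi t) -> perm_eq s t) ->
  nb_factorisations n <= nb_factorisations n'.
Proof.
move=> n0 n'0 phiP inj_phi.
apply: (@leq_card_fset_set _ _ _ _
  (fun s : {mset nat}%mset => seq_mset (map phi s))).
- exact: finite_factorisations.
- exact: finite_factorisations.
- move=> s /factorisesP /phiP fs; apply/factorisesP.
  by rewrite (perm_factorises _ _ _ (perm_eq_seq_mset _)).
- move=> s t /factorisesP fs /factorisesP ft /eq_seq_msetP st.
  rewrite -[s]seq_mset_id -[t]seq_mset_id; apply/eq_seq_msetP.
  exact: inj_phi.
Qed.

Lemma card_leq_nb_factorisations (n : nat) (T : finType) (g : T -> seq nat) :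
  0 < n -> (forall t, factorises n (g t)) ->
  (forall t u, perm_eq (g t) (g u) -> t = u) ->
  #|T| <= nb_factorisations n.
Proof.
move=> n0 gP inj_g.
have inj : injective (fun t => seq_mset (g t)).
  by move=> t u /eq_seq_msetP; exact: inj_g.
rewrite cardE -(size_map (fun t => seq_mset (g t))) /nb_factorisations.
apply: uniq_leq_size; first by rewrite map_inj_uniq// enum_uniq.
move=> _ /mapP[t _ ->]; rewrite in_fset_set; last exact: finite_factorisations.
rewrite inE; apply/factorisesP.
by rewrite (perm_factorises _ _ _ (perm_eq_seq_mset _)).
Qed.

(** * Lower bounds for f from the prime exponents *)

Lemma dvdn_prod_prime_exp (n e : nat) (ps : seq nat) : 0 < n -> uniq ps ->
  (forall p, p \in ps -> prime p /\ e <= logn p n) ->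
  \prod_(p <- ps) p ^ e %| n.
Proof.
move=> n0; elim: ps => [|p ps IHps] /=; first by rewrite big_nil dvd1n.
case/andP=> pps ups psP; have [pp ep] := psP p (mem_head _ _).
have {}psP q : q \in ps -> prime q /\ e <= logn q n.
  by move=> qps; apply: psP; rewrite inE qps orbT.
rewrite big_cons Gauss_dvd ?IHps// ?pfactor_dvdn// ?ep//.
rewrite big_seq; apply: (big_ind (coprime (p ^ e))) => [|a b ca cb|q qps].
- exact: coprimen1.
- by rewrite coprimeMr ca.
- apply/coprimeXl/coprimeXr; rewrite prime_coprime// dvdn_prime2//.
    by apply: contraNneq pps => ->.
  by have [] := psP q qps.
Qed.

(* A set A of pairs (i, a) yields the factorisation of n into the p_i^(a+1) with
   (i, a) in A and one cofactor; the cofactor is divisible by all the p_i^(s+1),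
   hence is not mistaken for a member of the family. *)
Lemma nb_factorisations_ge_exp (n s : nat) (ps : seq nat) :
  0 < n -> uniq ps -> 0 < size ps ->
  (forall p, p \in ps -> prime p /\ s.+1 ^ 2 <= logn p n) ->
  2 ^ (size ps * s) <= nb_factorisations n.
Proof.
move=> n0 ups sz psP.
pose p (i : 'I_(size ps)) := tnth (in_tuple ps) i.
have pps i : p i \in ps by exact: mem_tnth.
have pp i : prime (p i) by have [] := psP _ (pps i).
pose T := ('I_(size ps) * 'I_s)%type.
pose F (x : T) := p x.1 ^ x.2.+1.
have F1 x : 1 < F x by rewrite -[1](exp1n x.2.+1) ltn_exp2r// prime_gt1.
have injF : injective F.
  move=> [i a] [j b]; rewrite /F /= => ij.
  have := congr1 (logn (p i)) ij; rewrite !lognX !logn_prime// eqxx muln1.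
  case: eqP => [pij|_]; last by rewrite muln0.
  rewrite muln1 => -[ab].
  have eij : i = j.
    apply/val_inj/eqP => /=; rewrite -(nth_uniq 0 (ltn_ord i) (ltn_ord j) ups).
    by move: pij; rewrite /p !(tnth_nth 0) /= => ->.
  by rewrite eij (val_inj ab).
pose D (A : {set T}) := \prod_(x in A) F x.
pose E := \prod_(q <- ps) q ^ s.+1.
have DE A : D A * E %| n.
  have DA : D A %| \prod_x F x.
    by rewrite [X in _ %| X](bigID (mem A)) dvdn_mulr.
  apply: (dvdn_trans (dvdn_mul DA (dvdnn _))).
  have -> : (\prod_x F x) * E = \prod_(q <- ps) q ^ (\sum_(a < s) a.+1 + s.+1).
    have -> : \prod_x F x = \prod_(q <- ps) \prod_(a < s) q ^ a.+1.
      by rewrite [RHS]big_tnth pair_bigA.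
    rewrite /E -big_split /=; apply: eq_bigr => q _.
    by rewrite expnD expn_sum.
  apply: dvdn_prod_prime_exp => // q /psP[qq hq]; split => //.
  apply: leq_trans hq.
  (* The whole family together with [E] uses each prime at most s^2 + s + 1 <= (s+1)^2 times. *)
  have : \sum_(a < s) a.+1 <= \sum_(a < s) s by apply: leq_sum.
  rewrite sum_nat_const card_ord => h.
  by apply: (leq_trans (leq_add h (leqnn _))); rewrite expnS expn1; nia.
have D0 A : 0 < D A by rewrite prodn_gt0// => x; exact: ltnW.
pose c A := n %/ D A.
have cD A : c A * D A = n.
  by rewrite divnK// (dvdn_trans _ (DE A))// dvdn_mulr.
have c0 A : 0 < c A by move: n0; rewrite -(cD A) muln_gt0 => /andP[].
have pc A i : p i ^ s.+1 %| c A.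
  have : E %| c A by rewrite -(dvdn_pmul2l (D0 A)) [D A * c A]mulnC cD DE.
  by apply: dvdn_trans; rewrite /E (big_rem _ (pps i)) /= dvdn_mulr.
have c1 A : 1 < c A.
  apply: leq_trans (dvdn_leq (c0 A) (pc A (Ordinal sz))).
  by rewrite -[1](exp1n s.+1) ltn_exp2r// prime_gt1.
have Fc A x : F x != c A.
  apply/eqP => Fxc; have := pc A x.1; rewrite -Fxc /F.
  by rewrite dvdn_Pexp2l ?prime_gt1// ltnS leqNgt ltn_ord.
have -> : 2 ^ (size ps * s) = #|{: {set T}}|.
  by rewrite -cardsT -powersetT card_powerset cardsT card_prod !card_ord.
apply: (@card_leq_nb_factorisations n _
  (fun A => c A :: [seq F x | x <- enum A])) => // [A|A B AB].
  rewrite /factorises /= c1 /= big_cons big_map big_enum /= cD eqxx andbT.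
  by apply/allP => _ /mapP[x _ ->]; exact: F1.
have mem (C : {set T}) x : (x \in C) = (F x \in c C :: [seq F y | y <- enum C]).
  by rewrite inE (negbTE (Fc _ _)) /= mem_map// mem_enum.
by apply/setP => x; rewrite !mem (perm_mem AB).
Qed.

(** A map g of ['I_m] to itself attaches the j-th prime of the second half to the g(j)-th prime of
    the first half. Each of the m resulting factors contains exactly one prime of the first half, so
    their multiset determines g. *)
Lemma nb_factorisations_ge_self_exp (n m : nat) (ps : seq nat) :
  0 < n -> uniq ps -> size ps = m + m ->
  (forall p, p \in ps -> prime p /\ p %| n) ->
  m ^ m <= nb_factorisations n.
Proof.
move=> n0 ups sz psP.
pose p (i : 'I_(m + m)) := nth 0 ps i.
have pps i : p i \in ps by rewrite mem_nth// sz.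
have pp i : prime (p i) by have [] := psP _ (pps i).
have injp i j : p i = p j -> i = j.
  move=> /eqP; rewrite nth_uniq ?sz// => /eqP; exact: val_inj.
pose d (g : {ffun 'I_m -> 'I_m}) i :=
  p (lshift m i) * \prod_(j | g j == i) p (rshift m j).
have dvd_d q g i : prime q -> q %| d g i ->
    q = p (lshift m i) \/ exists2 j, g j = i & q = p (rshift m j).
  move=> pq; rewrite Euclid_dvdM// dvdn_prime2// => /orP[/eqP->|].
    by left.
  rewrite Euclid_dvd_prod// big_has_cond => /hasP[j _ /andP[/eqP gj]].
  by rewrite dvdn_prime2// => /eqP->; right; exists j.
have d1 g i : 1 < d g i.
  apply: (@leq_trans (p (lshift m i))); first exact: prime_gt1.
  by rewrite leq_pmulr// prodn_gt0// => j; exact: prime_gt0.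
pose N := \prod_(q <- ps) q.
have prod_d g : \prod_i d g i = N.
  rewrite big_split /= /N (big_nth 0) big_mkord sz big_split_ord /=.
  by congr (_ * _); rewrite [RHS](partition_big g xpredT)//.
have Nn : N %| n.
  have -> : N = \prod_(q <- ps) q ^ 1 by apply: eq_bigr => q _; rewrite expn1.
  apply: dvdn_prod_prime_exp => // q /psP[pq qn]; split=> //.
  by rewrite -pfactor_dvdn// expn1.
(* The cofactor, dropped when it is 1; it does not depend on g and so cancels when two
   factorisations are compared. *)
pose r := [seq x <- [:: n %/ N] | 1 < x].
have -> : m ^ m = #|{ffun 'I_m -> 'I_m}| by rewrite card_ffun !card_ord.
apply: (@card_leq_nb_factorisations n _
  (fun g => r ++ [seq d g i | i <- enum 'I_m])) => // [g|g h].
  rewrite /factorises all_cat filter_all /=; apply/andP; split.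
    by apply/allP => _ /mapP[i _ ->]; exact: d1.
  rewrite big_cat big_map big_enum /= prod_d big_filter.
  have N0 : 0 < N := dvdn_gt0 n0 Nn.
  have nN : 0 < n %/ N by rewrite divn_gt0// dvdn_leq.
  rewrite big_cons big_nil; case: ifP => [_|/negbT].
    by rewrite muln1 divnK.
  rewrite -leqNgt => nN1.
  have nN_eq1 : n %/ N = 1 by apply/eqP; rewrite eqn_leq nN1.
  by rewrite mul1n -[eqbRHS](divnK Nn) nN_eq1 mul1n.
rewrite perm_cat2l => gh; apply/ffunP => j.
(* The factor [d g i] equals some [d h k]; since [p (lshift m i)] divides it, k = i. *)
have dgh i : d g i = d h i.
  have : d g i \in [seq d h k | k <- enum 'I_m].
    by rewrite -(perm_mem gh) map_f// mem_enum.
  case/mapP => k _ gihk.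
  have : p (lshift m i) %| d h k by rewrite -gihk dvdn_mulr.
  case/dvd_d => // [/injp /lshift_inj ik|[l _ /injp /eqP]].
    by rewrite gihk ik.
  by rewrite eq_lrshift.
have : p (rshift m j) %| d h (g j).
  by rewrite -dgh /d (bigD1 j)//= mulnCA dvdn_mulr.
case/dvd_d => // [/injp /eqP|[l hl /injp /rshift_inj jl]].
  by rewrite eq_rlshift.
by rewrite -hl jl.
Qed.

(** * Moving factorisations from one set of primes to another *)

Lemma prod_exp_logn (n : nat) (ps : seq nat) : 0 < n -> uniq ps ->
  {subset primes n <= ps} -> \prod_(p <- ps) p ^ logn p n = n.
Proof.
move=> n0 ups sub; rewrite [RHS]prod_prime_decomp// prime_decompE big_map /=.
rewrite (bigID (mem (primes n))) /= [X in _ * X]big1 => [|p]; last first.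
  by rewrite -logn_gt0 -eqn0Ngt => /eqP->.
rewrite muln1 -big_filter; apply: perm_big; apply: uniq_perm.
- exact: filter_uniq.
- exact: primes_uniq.
- move=> p; rewrite mem_filter; apply: andb_idr; exact: sub.
Qed.

(* The exponent of d at the i-th prime of ps becomes the exponent at the i-th
   prime of qs; the part of d prime to ps is dropped. *)
Definition transfer (ps qs : seq nat) (d : nat) : nat :=
  \prod_(i < size ps) nth 0 qs i ^ logn (nth 0 ps i) d.

Section Transfer.
Variables ps qs : seq nat.
Hypotheses (ups : uniq ps) (uqs : uniq qs) (size_pq : size ps = size qs).
Hypotheses (prime_qs : forall q, q \in qs -> prime q).

Let prime_nth_qs (i : 'I_(size ps)) : prime (nth 0 qs i).
Proof. by apply/prime_qs/mem_nth; rewrite -size_pq. Qed.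

Lemma transfer_gt0 (d : nat) : 0 < transfer ps qs d.
Proof. by rewrite prodn_gt0// => i; rewrite expn_gt0 prime_gt0. Qed.

Lemma transfer1 : transfer ps qs 1 = 1.
Proof. by rewrite /transfer big1// => i _; rewrite logn1. Qed.

Lemma transferM (a b : nat) : 0 < a -> 0 < b ->
  transfer ps qs (a * b) = transfer ps qs a * transfer ps qs b.
Proof.
move=> a0 b0; rewrite -big_split; apply: eq_bigr => i _.
by rewrite lognM ?expnD.
Qed.

Lemma transfer_prod (s : seq nat) : all (ltn 0) s ->
  transfer ps qs (\prod_(d <- s) d) = \prod_(d <- map (transfer ps qs) s) d.
Proof.
elim: s => [_|d s IHs /= /andP[d0 s0]]; first by rewrite !big_nil transfer1.
rewrite !big_cons transferM ?IHs// big_seq_cond prodn_cond_gt0// => e.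
by rewrite andbT; exact/allP.
Qed.

Lemma logn_transfer (d i : nat) : i < size ps ->
  logn (nth 0 qs i) (transfer ps qs d) = logn (nth 0 ps i) d.
Proof.
move=> ips; pose i' := Ordinal ips.
(* The other terms are powers of other primes of [qs], hence coprime to the i-th one. *)
rewrite /transfer (bigD1 i')//= mulnC logn_Gauss; last first.
  apply: (big_ind (coprime (nth 0 qs i))) => [|a b ca cb|j ji].
  - exact: coprimen1.
  - by rewrite coprimeMr ca.
  - apply: coprimeXr; rewrite prime_coprime ?(prime_nth_qs i')//.
    rewrite dvdn_prime2 ?(prime_nth_qs i')// nth_uniq// -?size_pq//.
    by rewrite eq_sym.
by rewrite lognX (logn_prime _ (prime_nth_qs i')) eqxx muln1.
Qed.

Lemma transferK (d : nat) : 0 < d -> {subset primes d <= ps} ->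
  transfer qs ps (transfer ps qs d) = d.
Proof.
move=> d0 dps; rewrite /transfer -size_pq.
under eq_bigr => i _ do rewrite logn_transfer//.
by rewrite -[RHS](prod_exp_logn _ ps)// (big_nth 0) big_mkord.
Qed.

End Transfer.

(** * Exponent patterns: invariance of f, bounds and counting *)

Definition decr_primes (n : nat) : seq nat :=
  sort (fun p q => logn q n <= logn p n) (primes n).

(** The multiset of exponents as a nonincreasing sequence: a bound on all but the largest few
    exponents becomes a bound on all entries from some index on. *)
Definition signature (n : nat) : seq nat :=
  [seq logn p n | p <- decr_primes n].

Lemma mem_decr_primes (n p : nat) : (p \in decr_primes n) = (p \in primes n).
Proof. by rewrite mem_sort. Qed.

Lemma decr_primes_uniq (n : nat) : uniq (decr_primes n).
Proof. by rewrite sort_uniq primes_uniq. Qed.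

Lemma prime_decr_primes (n p : nat) : p \in decr_primes n -> prime p.
Proof. by rewrite mem_decr_primes mem_primes => /andP[]. Qed.

(** Matching primes of equal exponent, [transfer] sends n to n' and is multiplicative, so it carries
    factorisations to factorisations; transferring back shows injectivity. *)
Lemma leq_nb_factorisations_signature (n n' : nat) : 0 < n -> 0 < n' ->
  signature n = signature n' -> nb_factorisations n <= nb_factorisations n'.
Proof.
move=> n0 n'0 sig.
set ps := decr_primes n; set qs := decr_primes n'.
have spq : size ps = size qs.
  by rewrite -(size_map (fun p => logn p n)) [map _ _]sig size_map.
have ups : uniq ps by exact: decr_primes_uniq.
have uqs : uniq qs by exact: decr_primes_uniq.
have pq q : q \in qs -> prime q by exact: prime_decr_primes.
have tn : transfer ps qs n = n'.
  rewrite -[RHS](prod_exp_logn _ qs)//; last first.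
    by move=> q; rewrite mem_decr_primes.
  rewrite (big_nth 0) big_mkord /transfer spq; apply: eq_bigr => i _.
  rewrite -(nth_map _ 0 (fun p => logn p n)) ?spq// [map _ _]sig.
  by rewrite (nth_map 0).
have factorisesK s d : factorises n s -> d \in s ->
    0 < d /\ transfer qs ps (transfer ps qs d) = d.
  case/andP => /allP s1 /eqP sn ds; have d0 : 0 < d by exact/ltnW/s1.
  split=> //; apply: transferK => // p.
  rewrite mem_decr_primes !mem_primes => /and3P[-> _ pd]; rewrite n0 /=.
  by rewrite -sn (big_rem _ ds) /= dvdn_mulr.
apply: (@leq_nb_factorisations _ _ (transfer ps qs)) => // [s fs|s t fs ft st].
  have /andP[/allP s1 /eqP sn] := fs.
  rewrite /factorises -transfer_prod//; last by apply/allP => d /s1 /ltnW.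
  rewrite sn tn eqxx andbT; apply/allP => _ /mapP[d ds ->] /=.
  have [d0 dK] := factorisesK _ _ fs ds.
  rewrite ltn_neqAle transfer_gt0// andbT.
  (* A factor sent to 1 would itself be 1, by transferring back. *)
  apply/eqP => td; have := s1 _ ds.
  by rewrite -dK -td transfer1.
have := perm_map (transfer qs ps) st.
rewrite -!map_comp.
rewrite (@map_id_in _ (_ \o _) s) => [|d /(factorisesK _ _ fs)[]//].
by rewrite (@map_id_in _ (_ \o _) t) => [|d /(factorisesK _ _ ft)[]//].
Qed.

(** All entries are positive, so the default 0 of [nth] marks the end and the entries determine the
    length. *)
Lemma nth_signature_gt0 (n i : nat) :
  (0 < nth 0 (signature n) i) = (i < size (signature n)).
Proof.
case: (ltnP i) => [|hi]; last by rewrite nth_default.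
rewrite size_map => hi; rewrite (nth_map 0)// logn_gt0.
by rewrite -mem_decr_primes mem_nth.
Qed.

Lemma size_signature_lt (n m : nat) : 0 < n ->
  nb_factorisations n < m ^ m -> size (signature n) < m + m.
Proof.
move=> n0; rewrite !ltnNge size_map; apply: contra => hm.
apply: (@nb_factorisations_ge_self_exp _ _
  (take (m + m) (decr_primes n))) => //.
- by rewrite take_uniq// decr_primes_uniq.
- exact: size_takel.
- move=> p /mem_take; rewrite mem_decr_primes mem_primes.
  by case/and3P.
Qed.

(** Indices start at 0: if entry i is at least (s+1)^2, so are the i+1 >= J entries up to it, and
    their primes give at least 2^(J s) factorisations. *)
Lemma nth_signature_lt (n s J i : nat) : 0 < n -> J <= i.+1 ->
  nb_factorisations n < 2 ^ (J * s) -> nth 0 (signature n) i < s.+1 ^ 2.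
Proof.
move=> n0 Ji; apply: contraTT; rewrite -!leqNgt => hi.
have iz : i < size (signature n).
  by rewrite -nth_signature_gt0 (leq_trans _ hi)// expn_gt0.
have := iz; rewrite size_map => iz'.
have sz : size (take i.+1 (decr_primes n)) = i.+1 by exact: size_takel.
apply: (@leq_trans (2 ^ (i.+1 * s))).
  by rewrite leq_exp2l// leq_mul2r Ji orbT.
rewrite -{1}sz; apply: nb_factorisations_ge_exp => // [||p].
- by rewrite take_uniq// decr_primes_uniq.
- by rewrite sz.
case/(nthP 0) => j; rewrite sz => ji; rewrite nth_take// => <-.
have jz : j < size (decr_primes n) by exact: leq_trans iz'.
split; first exact/prime_decr_primes/mem_nth.
apply: (leq_trans hi); rewrite (nth_map 0)//.
have tr : transitive (fun p q => logn q n <= logn p n).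
  by move=> y x z /= xy yz; exact: leq_trans xy.
apply: (sorted_leq_nth tr _ 0 (sort_sorted _ (primes n))) => //=.
by move=> a b; exact: leq_total.
Qed.

(** Each value is encoded by the signature of a chosen preimage: J entries below (t+1)^2, then a
    block of 2m entries below (s+1)^2. The three bounds on a control the length, the late entries
    and all entries. *)
Lemma card_values_le_leq (R : realType) (x : R) (m s t J : nat) :
  (forall a, values_le x a -> [/\ a < m ^ m, a < 2 ^ (J * s) & a < 2 ^ t]) ->
  card_values_le x <= (t.+1 ^ 2) ^ J * (s.+1 ^ 2) ^ (m + m).
Proof.
move=> bnd.
pose N (a : nat) : nat := xget 0 [set n | 0 < n /\ nb_factorisations n = a].
have NP a : values_le x a -> 0 < N a /\ nb_factorisations (N a) = a.
  move=> [[n /= n0 na] _].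
  by apply: (@xgetPex _ 0 [set k | 0 < k /\ nb_factorisations k = a]); exists n.
have t0 : 0 < t.+1 ^ 2 by rewrite expn_gt0.
have s0 : 0 < s.+1 ^ 2 by rewrite expn_gt0.
pose T := ({ffun 'I_J -> 'I_(t.+1 ^ 2)} *
           {ffun 'I_(m + m) -> 'I_(s.+1 ^ 2)})%type.
(* The defaults of [insubd] are never taken on [values_le x], where the bounds hold; the second
   block starts at index J and reaches past the end of the signature. *)
pose code a : T :=
  ([ffun i : 'I_J => insubd (Ordinal t0) (nth 0 (signature (N a)) i)],
   [ffun i : 'I_(m + m) =>
     insubd (Ordinal s0) (nth 0 (signature (N a)) (J + i))]).
have -> : (t.+1 ^ 2) ^ J * (s.+1 ^ 2) ^ (m + m) = #|{: T}|.
  by rewrite card_prod !card_ffun !card_ord.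
have val_of a : a \in fset_set (values_le x) -> values_le x a.
  by rewrite in_fset_set ?inE//; exact: finite_values_le.
rewrite /card_values_le -(size_map code) cardE.
apply: uniq_leq_size => [|c _]; last by rewrite mem_enum.
rewrite map_inj_in_uniq ?fset_uniq// => a b /val_of va /val_of vb [codeI codeJ].
have [[Na0 fNa] [Nb0 fNb]] := (NP _ va, NP _ vb).
have bound c : values_le x c ->
    [/\ size (signature (N c)) < m + m,
        forall i, nth 0 (signature (N c)) i < t.+1 ^ 2 &
        forall i, J <= i -> nth 0 (signature (N c)) i < s.+1 ^ 2].
  move=> vc; have [Nc0 fNc] := NP _ vc; have [b1 b2 b3] := bnd _ vc.
  split=> [|i|i Ji]; first by rewrite size_signature_lt// fNc.
    (* A single prime suffices here, so the bound holds at every index. *)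
    by apply: (@nth_signature_lt _ _ 1); rewrite ?fNc ?mul1n.
  by apply: (@nth_signature_lt _ _ J); rewrite ?fNc// leqW.
have [sza ta sa] := bound _ va; have [szb tb sb] := bound _ vb.
have eq_nth i : nth 0 (signature (N a)) i = nth 0 (signature (N b)) i.
  case: (ltnP i J) => [iJ|Ji].
    move: codeI => /ffunP /(_ (Ordinal iJ)); rewrite !ffunE /=.
    move=> /(congr1 val); rewrite /= !insubdK// -topredE /=;
      [exact: tb|exact: ta].
  case: (ltnP i (m + m)) => [im|mi]; last first.
    by rewrite !nth_default// (leq_trans _ mi)// ltnW.
  have im' : i - J < m + m by rewrite (leq_ltn_trans _ im)// leq_subr.
  move: codeJ => /ffunP /(_ (Ordinal im')); rewrite !ffunE /= subnKC//.
  move=> /(congr1 val); rewrite /= !insubdK// -topredE /=;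
    [exact: sb|exact: sa].
have eq_sig : signature (N a) = signature (N b).
  apply: (@eq_from_nth _ 0) => [|i _]; last exact: eq_nth.
  apply/eqP; rewrite eqn_leq.
  rewrite leqNgt -nth_signature_gt0 eq_nth nth_signature_gt0 ltnn /=.
  by rewrite leqNgt -nth_signature_gt0 -eq_nth nth_signature_gt0 ltnn.
rewrite -fNa -fNb; apply/eqP; rewrite eqn_leq.
by rewrite !leq_nb_factorisations_signature.
Qed.

(** * Choice of the parameters and real estimates *)

Local Open Scope ring_scope.

(** Square e^(u/2) >= 1 + u/2 and use (1 + u/2)^2 - 2u = (1 - u/2)^2. *)
Lemma expR_ge2x (R : realType) (u : R) : 0 <= u -> 2 * u <= expR u.
Proof.
move=> u0; have -> : expR u = expR (u / 2) ^+ 2.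
  by rewrite -expRM_natr; congr expR; field.
have h : (1 + u / 2) ^+ 2 <= expR (u / 2) ^+ 2.
  by apply: lerXn2r; rewrite ?nnegrE ?expR_ge0 ?expR_ge1Dx//; lra.
by apply: le_trans h; have := sqr_ge0 (1 - u / 2); lra.
Qed.

Lemma expR_half_le2 (R : realType) : expR (2^-1 : R) <= 2.
Proof.
have := expR_ge1Dx (- 2^-1 : R); rewrite expRN => h.
have h0 := expR_gt0 (2^-1 : R).
have : expR (2^-1 : R) * (expR 2^-1)^-1 = 1 by rewrite mulfV// gt_eqF.
by nra.
Qed.

Lemma expX_leqR (R : realType) (u v : R) (b k : nat) :
  b%:R <= expR u -> u * k%:R <= v -> (b ^ k)%:R <= expR v.
Proof.
move=> bu ukv; rewrite natrX; apply: (@le_trans _ _ (expR u ^+ k)).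
  by apply: lerXn2r => //; rewrite nnegrE ?ler0n ?expR_ge0.
by rewrite -expRM_natr ler_expR.
Qed.

Lemma expX_gtR (R : realType) (u v : R) (b k : nat) :
  expR u <= b%:R -> v < u * k%:R -> expR v < (b ^ k)%:R.
Proof.
move=> bu ukv; rewrite natrX; apply: (@lt_le_trans _ _ (expR u ^+ k)).
  by rewrite -expRM_natr ltr_expR.
by apply: lerXn2r => //; rewrite nnegrE ?ler0n ?expR_ge0.
Qed.

(** Here L, y, z are the first three iterated logarithms of x; taking them as variables keeps [ln]
    out of the estimates. *)
Lemma card_values_le_expR (R : realType) (L y z : R) :
  1 <= z -> y = expR z -> L = expR y ->
  (card_values_le (expR L))%:R <= expR (48 * z / y * L).
Proof.
move=> z1 yz Ly.
have y2 : 2 * z <= y by rewrite yz expR_ge2x//; lra.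
have L2 : 2 * y <= L by rewrite Ly expR_ge2x//; lra.
have hy : y <= expR (y / 2).
  have := @expR_ge2x R (y / 2).
  by rewrite (_ : 2 * (y / 2) = y); [apply; lra|field].
have LE : L = expR (y / 2) ^+ 2.
  by rewrite -expRM_natr Ly; congr expR; field.
have y0 : 0 < y by lra.
have yy : y ^+ 2 <= L by rewrite LE; nra.
pose up (u : R) := (Num.truncn u).+1.
have upP u : 0 <= u -> u < (up u)%:R /\ (up u)%:R <= u + 1.
  move=> u0; have /andP[h1 h2] := truncn_itv u0; split=> //.
  by rewrite /up -natr1 lerD2r.
have Ly0 : 0 <= 2 * L / y by rewrite divr_ge0//; lra.
have Lyy0 : 0 <= 2 * L / y ^+ 2 by rewrite divr_ge0// ?exprn_ge0//; lra.
have L0 : 0 <= 2 * L by lra.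
have yy0 : 0 <= y ^+ 2 by rewrite exprn_ge0// ltW.
(* The factors 2 compensate for m >= e^(y/2) and 2 >= e^(1/2): each of m^m, 2^(J s) and 2^t then
   exceeds e^L. *)
set m := up (2 * L / y); set s := up (y ^+ 2).
set t := up (2 * L); set J := up (2 * L / y ^+ 2).
have [m1 m2] := upP _ Ly0; have [J1 J2] := upP _ Lyy0.
have [t1 t2] := upP _ L0; have [s1 s2] := upP _ yy0.
rewrite -/m -/s -/t -/J in m1 m2 J1 J2 t1 t2 s1 s2.
have sqrt2 : expR (2^-1 : R) <= 2%:R by exact: expR_half_le2.
have my : 2 * L < m%:R * y by rewrite -ltr_pdivrMr.
have Jy : 2 * L < J%:R * y ^+ 2 by rewrite -ltr_pdivrMr// exprn_gt0.
have bnd a : values_le (expR L) a ->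
    [/\ (a < m ^ m)%N, (a < 2 ^ (J * s))%N & (a < 2 ^ t)%N].
  case=> _ aL; split; rewrite -(ltr_nat R); apply: (le_lt_trans aL).
  - apply: (@expX_gtR _ (y / 2)); last by lra.
    apply: le_trans (ltW m1); rewrite ler_pdivlMr//.
    by rewrite LE; have := expR_ge0 (y / 2); nra.
  - apply: (@expX_gtR _ _ _ _ _ sqrt2); rewrite natrM.
    have : J%:R * y ^+ 2 <= J%:R * s%:R :> R by rewrite ler_wpM2l// ltW.
    by lra.
  - by apply: (@expX_gtR _ _ _ _ _ sqrt2); lra.
have := card_values_le_leq _ _ _ _ _ _ bnd.
rewrite -(ler_nat R) => /le_trans; apply.
have Lz : 0 <= L / y by rewrite divr_ge0//; lra.
(* The first block costs 4 J y <= 12 L/y, as t+1 <= L^2 = e^(2y). The second costs 12 m z <= 36 z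
   L/y, as s+1 <= y^3 = e^(3z), and 36 z <= 12 (4z - 1) because z >= 1. *)
have -> : 48 * z / y * L = 12 * (L / y) + (12 * (L / y) * (4 * z - 1)).
  by field; rewrite gt_eqF.
have JJ : J%:R * y <= 3 * (L / y).
  have -> : 3 * (L / y) = (3 * L / y ^+ 2) * y by field; rewrite gt_eqF.
  rewrite ler_pM2r//; apply: (le_trans J2).
  have : 1 <= L / y ^+ 2 by rewrite ler_pdivlMr ?mul1r// exprn_gt0.
  by lra.
have mm : m%:R <= 3 * (L / y).
  have : 1 <= L / y by rewrite ler_pdivlMr ?mul1r//; lra.
  by lra.
rewrite natrM expRD; apply: ler_pM; rewrite ?ler0n//.
  rewrite -expnM; apply: (@expX_leqR _ (2 * y)); last by rewrite natrM; lra.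
  have -> : expR (2 * y) = L ^+ 2 by rewrite Ly -expRM_natr mulrC.
  by rewrite -natr1; nra.
rewrite -expnM; apply: (@expX_leqR _ (3 * z)).
  have -> : expR (3 * z) = y ^+ 3 by rewrite yz -expRM_natr mulrC.
  rewrite -natr1 exprS.
  have : 2 * y ^+ 2 <= y * y ^+ 2 by rewrite ler_wpM2r//; lra.
  have : 4 <= y ^+ 2 by nra.
  by lra.
rewrite natrM natrD.
have : m%:R * z <= 3 * (L / y) * z by rewrite ler_wpM2r//; lra.
have : L / y <= L / y * z by rewrite ler_peMr.
by lra.
Qed.

Theorem theorem1 (R : realType) :
  exists C x0 : R, 0 < C /\
    forall x : R, x0 <= x ->
      (card_values_le x)%:R <= x `^ (C * ln (ln (ln x)) / ln (ln x)).
Proof.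
(* This threshold makes log log log x at least 1. *)
exists 48, (expR (expR (expR 1))); split=> // x x0x.
have ln_ge (u v : R) : expR u <= v -> expR (ln v) = v /\ u <= ln v.
  move=> uv; have v0 : 0 < v := lt_le_trans (expR_gt0 u) uv.
  have lnv : expR (ln v) = v by rewrite lnK// posrE.
  by split=> //; rewrite -ler_expR lnv.
have [xE Lx] := ln_ge _ _ x0x; have [LE yL] := ln_ge _ _ Lx.
have [yE zy] := ln_ge _ _ yL.
rewrite -{1}xE -{2}xE -expRM.
have := card_values_le_expR _ _ _ _ zy (esym yE) (esym LE).
by rewrite mulrC.
Qed.
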